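(* Let $Y\to X$ be a fibred manifold, $L$ a semiregular Lagrangian density on $J^1Y$, $\widehat L:J^1Y\to\Pi$ its Legendre morphism and $Q=\widehat L(J^1Y)$ the constraint space. (i) Let $H$ be a Hamiltonian form associated with $L$ and let a section $r$ of $\Pi\to X$ be a solution of the Hamilton equations for $H$. If $r$ lives on $Q$ (takes values in $Q$), then the section $\overline s=\widehat H\circ r$ of $J^1Y\to X$ satisfies the first order Euler–Lagrange equations for $L$. (ii) Let $\overline s$ be a section of $J^1Y\to X$ which is a solution of the first order Euler–Lagrange equations for $L$, and let $H$ be a Hamiltonian form associated with $L$ such that $$\widehat H\circ\widehat L\circ\overline s=\overline s .$$ Then the section $r=\widehat L\circ\overline s$ of $\Pi\to X$ is a solution of the Hamilton equations for $H$, and it lives on $Q$. (iii) For all sections $\overline s$ and $r$ as in (i) or as in (ii), one has $$\overline s=J^1s,\qquad s=\pi_{\Pi Y}\circ r,$$ where $\pi_{\Pi Y}:\Pi\to Y$ is the projection and $s$ is a solution of the second order Euler–Lagrange equations for $L$.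
   Context: All manifolds are real, smooth, Hausdorff, second-countable, finite-dimensional and connected; maps are smooth. A fibred manifold is a surjective submersion $Y\to X$, $n=\dim X$, with fibred coordinates $(x^\lambda,y^i)$; its first order jet manifold $J^1Y$ has coordinates $(x^\lambda,y^i,y^i_\lambda)$. Put $\omega=dx^1\wedge\dots\wedge dx^n$, $\omega_\lambda=\partial_\lambda\rfloor\omega$. A (first order) Lagrangian density is a horizontal density $L=\mathcal L(x^\mu,y^i,y^i_\mu)\omega$ on $J^1Y\to X$; $\pi^\lambda_i=\partial\mathcal L/\partial y^i_\lambda$. The Legendre manifold is $\Pi=\bigwedge^nT^*X\otimes_Y TX\otimes_Y V^*Y$ with coordinates $(x^\lambda,y^i,p^\lambda_i)$. The Legendre morphism $\widehat L:J^1Y\to\Pi$ over $Y$ is $p^\lambda_i\circ\widehat L=\pi^\lambda_i$. $L$ is semiregular if for every $p\in Q=\widehat L(J^1Y)$ the preimage $\widehat L^{-1}(p)$ is a connected submanifold of $J^1Y$. A Hamiltonian form on $\Pi$ is an $n$-form $H=p^\lambda_i dy^i\wedge\omega_\lambda-p^\lambda_i\Gamma^i_\lambda\omega-\widetilde{\mathcal H}_\Gamma\omega=p^\lambda_i dy^i\wedge\omega_\lambda-\mathcal H\omega$, where $\Gamma$ is a connection on $Y\to X$ and $\widetilde{\mathcal H}_\Gamma\omega$ is a horizontal density on $\Pi\to X$. It defines the momentum morphism $\widehat H:\Pi\to J^1Y$ over $Y$, $y^i_\lambda\circ\widehat H=\partial\mathcal H/\partial p^\lambda_i$. For a fibred morphism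 $\Phi:\Pi\to J^1Y$ over $Y$ put $H_\Phi=p^\lambda_i dy^i\wedge\omega_\lambda-p^\lambda_i\Phi^i_\lambda\omega$. $H$ is associated with $L$ if $\widehat L\circ\widehat H|_Q=\mathrm{Id}_Q$ and $H=H_{\widehat H}+L\circ\widehat H$ on $\Pi$. Hamilton equations for a section $r=(r^i(x),r^\lambda_i(x))$ of $\Pi\to X$: $\partial_\lambda r^i=\frac{\partial\mathcal H}{\partial p^\lambda_i}\circ r$ and $\partial_\lambda r^\lambda_i=-\frac{\partial\mathcal H}{\partial y^i}\circ r$. First order Euler–Lagrange equations for a section $\overline s=(\overline s^i,\overline s^i_\lambda)$ of $J^1Y\to X$: $\partial_\lambda\overline s^i=\overline s^i_\lambda$ and $\frac{\partial\mathcal L}{\partial y^i}-\big(\partial_\lambda+\overline s^j_\lambda\frac{\partial}{\partial y^j}+\partial_\lambda\overline s^j_\mu\frac{\partial}{\partial y^j_\mu}\big)\frac{\partial\mathcal L}{\partial y^i_\lambda}=0$ (evaluated along $\overline s$). Second order Euler–Lagrange equations for a section $s$ of $Y\to X$: $\frac{\partial\mathcal L}{\partial y^i}\circ J^1s-\partial_\lambda\big(\frac{\partial\mathcal L}{\partial y^i_\lambda}\circ J^1s\big)=0$, where $J^1s$ is the jet prolongation, $y^i_\lambda\circ J^1s=\partial_\lambda s^i$. *)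

(* Defs.v *)
From HB Require Import structures.
From mathcomp Require Import all_boot all_order all_algebra.
From mathcomp Require Import all_classical all_reals all_analysis.
Set Implicit Arguments.
Unset Strict Implicit.
Unset Printing Implicit Defensive.
Import Order.TTheory GRing.Theory Num.Theory.
Import numFieldNormedType.Exports.
Local Open Scope classical_set_scope.
Local Open Scope ring_scope.

(* C^oo maps between open subsets of normed spaces: all iterated directional
   derivatives exist and are Frechet differentiable on U. *)

Fixpoint iter_derive (R : realType) (V W : normedModType R) (vs : seq V)
    (f : V -> W) : V -> W :=
  if vs is v :: vs' then (fun x => 'D_v (iter_derive vs' f) x) else f.

Definition smooth_on (R : realType) (V W : normedModType R) (U : set V)
    (f : V -> W) : Prop :=
  forall (vs : seq V) (x : V), U x -> differentiable (iter_derive vs f) x.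

(* A chart is a homeomorphism from an open set of M onto an open set of E. The
   total functions cmap and cinv are meaningful on cdom and cimg only. *)
Record chart (R : realType) (M : topologicalType) (E : normedModType R) := Chart {
  cdom : set M;
  cmap : M -> E;
  cinv : E -> M;
  cdom_open : open cdom;
  cimg_open : open (cmap @` cdom);
  cmapK : forall p, cdom p -> cinv (cmap p) = p;
  cmap_continuous : forall p, cdom p -> {for p, continuous cmap};
  cinv_continuous : forall e, (cmap @` cdom) e -> {for e, continuous cinv}
}.

Definition cimg (R : realType) (M : topologicalType) (E : normedModType R)
    (c : chart M E) : set E := cmap c @` cdom c.

Definition compatible (R : realType) (M : topologicalType) (E : normedModType R)
    (c c' : chart M E) : Prop :=
  smooth_on (cmap c @` (cdom c `&` cdom c')) (cmap c' \o cinv c).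

(* Connected, Hausdorff, second-countable; atlas is the maximal one. *)
Record manifold (R : realType) (E : normedModType R) := Manifold {
  msort :> topologicalType;
  atlas : set (chart msort E);
  m_hausdorff : hausdorff_space msort;
  m_second_countable : @second_countable msort;
  m_connected : connected [set: msort];
  atlas_cover : forall p : msort, exists2 c, atlas c & cdom c p;
  atlas_compatible : forall c c', atlas c -> atlas c' -> compatible c c';
  atlas_maximal : forall c, (forall c', atlas c' ->
    compatible c c' /\ compatible c' c) -> atlas c
}.

Definition smooth_map (R : realType) (E E' : normedModType R)
    (M : manifold E) (N : manifold E') (f : M -> N) : Prop :=
  continuous f /\
  forall (c : chart M E) (c' : chart N E'), atlas c -> atlas c' ->
    smooth_on (cmap c @` (cdom c `&` f @^-1` cdom c'))
      (cmap c' \o f \o cinv c).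

(* The differential of f at p, read in any charts, is onto. *)
Definition submersion (R : realType) (E E' : normedModType R)
    (M : manifold E) (N : manifold E') (f : M -> N) : Prop :=
  smooth_map f /\
  forall (c : chart M E) (c' : chart N E') (p : M), atlas c -> atlas c' ->
    cdom c p -> cdom c' (f p) ->
    forall w : E', exists v : E, 'd (cmap c' \o f \o cinv c) (cmap c p) v = w.

(* S is an embedded submanifold of the normed space E: around each of its
   points, some diffeomorphism between open sets of E straightens S into a
   linear subspace F. *)
Definition embedded_submanifold (R : realType) (E : normedModType R)
    (S : set E) : Prop :=
  forall a, S a -> exists (c : chart E E) (F : set E),
    [/\ cdom c a, smooth_on (cdom c) (cmap c), smooth_on (cimg c) (cinv c),
        F 0 /\ (forall (k : R) u v, F u -> F v -> F (k *: u + v)) &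
        cmap c @` (S `&` cdom c) = cimg c `&` F].

(* Fibred manifolds Y -> X with dim X = n and dim Y = n + m; R^(n+m) is
   written as the product R^n x R^m. *)
Record fibred_manifold (R : realType) (n m : nat) := FibredManifold {
  fX : manifold 'rV[R]_n;
  fY : manifold ('rV[R]_n * 'rV[R]_m)%type;
  fproj : fY -> fX;
  fproj_surj : forall x : fX, exists y : fY, fproj y = x;
  fproj_submersion : submersion fproj
}.

(* Fibred coordinates (x^lambda, y^i). *)
Record fchart (R : realType) (n m : nat) (F : fibred_manifold R n m) := FChart {
  bchart : chart (fX F) 'rV[R]_n;
  tchart : chart (fY F) ('rV[R]_n * 'rV[R]_m)%type;
  bchart_atlas : atlas bchart;
  tchart_atlas : atlas tchart;
  fchart_dom : forall y, cdom tchart y -> cdom bchart (fproj y);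
  fchart_proj : forall y, cdom tchart y ->
    (cmap tchart y).1 = cmap bchart (fproj y)
}.

Definition fdom (R : realType) (n m : nat) (F : fibred_manifold R n m)
  (c : fchart F) : set (fY F) := cdom (tchart c).

(* Jacobian matrices at y of the change of fibred coordinates
   (x, y) |-> (x', y') from c to c':
     jacX mu lam = dx'^lam / dx^mu,  jacXY mu i = dy'^i / dx^mu,
     jacY j i = dy'^i / dy^j. *)
Definition jacX (R : realType) (n m : nat) (F : fibred_manifold R n m)
    (c c' : fchart F) (y : fY F) : 'M[R]_n :=
  \matrix_(mu, lam)
    ('D_(delta_mx 0 mu) (cmap (bchart c') \o cinv (bchart c))
       (cmap (bchart c) (fproj y))) 0 lam.

Definition jacXY (R : realType) (n m : nat) (F : fibred_manifold R n m)
    (c c' : fchart F) (y : fY F) : 'M[R]_(n, m) :=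
  \matrix_(mu, i)
    ('D_((delta_mx 0 mu, 0) : 'rV[R]_n * 'rV[R]_m)
       (cmap (tchart c') \o cinv (tchart c)) (cmap (tchart c) y)).2 0 i.

Definition jacY (R : realType) (n m : nat) (F : fibred_manifold R n m)
    (c c' : fchart F) (y : fY F) : 'M[R]_m :=
  \matrix_(j, i)
    ('D_((0, delta_mx 0 j) : 'rV[R]_n * 'rV[R]_m)
       (cmap (tchart c') \o cinv (tchart c)) (cmap (tchart c) y)).2 0 i.

(* Bundles over Y with fibre 'M_(n, m), given by a transition law for the
   fibre coordinates. *)
Definition fibre_law (R : realType) (n m : nat) (F : fibred_manifold R n m) :=
  fchart F -> fchart F -> fY F -> 'M[R]_(n, m) -> 'M[R]_(n, m).

(* y'^i_lam = (dx^mu/dx'^lam) (d_mu + y^j_mu d_j) y'^i,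
   where the matrix entry v lam i is y^i_lam. *)
Definition jet_law (R : realType) (n m : nat) (F : fibred_manifold R n m) :
    fibre_law F :=
  fun c c' y v => jacX c' c y *m (jacXY c c' y + v *m jacY c c' y).

(* p'^lam_i = det (dx^eps/dx'^nu) (dx'^lam/dx^mu) (dy^j/dy'^i) p^mu_j,
   where the matrix entry p lam i is p^lam_i. *)
Definition legendre_law (R : realType) (n m : nat) (F : fibred_manifold R n m) :
    fibre_law F :=
  fun c c' y p => \det (jacX c' c y) *:
    ((jacX c c' y)^T *m p *m (jacY c' c y)^T).

(* A point of such a bundle: a point y of Y and a compatible family of fibre
   coordinates, one matrix for each fibred chart at y (and the dummy value 0
   for the other charts, so that equal points have equal coordinates). *)
Record bundle (R : realType) (n m : nat) (F : fibred_manifold R n m)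
    (tr : fibre_law F) := BundlePoint {
  base : fY F;
  fcoord : fchart F -> 'M[R]_(n, m);
  fcoord_law : forall c c', fdom c base -> fdom c' base ->
    fcoord c' = tr c c' base (fcoord c);
  fcoord_out : forall c, ~ fdom c base -> fcoord c = 0
}.

Notation jet F := (bundle (@jet_law _ _ _ F)).
Notation legendre F := (bundle (@legendre_law _ _ _ F)).

(* Coordinates (x^lambda, y^i, y^i_lambda) or (x^lambda, y^i, p^lambda_i). *)
Notation coord_space R n m := ('rV[R]_n * 'rV[R]_m * 'M[R]_(n, m))%type.

Definition coords (R : realType) (n m : nat) (F : fibred_manifold R n m)
    (tr : fibre_law F) (c : fchart F) (q : bundle tr) : coord_space R n m :=
  (cmap (tchart c) (base q), fcoord q c).

(* The manifold topology, generated by the coordinate domains. *)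
HB.instance Definition _ (R : realType) (n m : nat) (F : fibred_manifold R n m)
  (tr : fibre_law F) := gen_eqMixin (bundle tr).
HB.instance Definition _ (R : realType) (n m : nat) (F : fibred_manifold R n m)
  (tr : fibre_law F) := gen_choiceMixin (bundle tr).
HB.instance Definition _ (R : realType) (n m : nat) (F : fibred_manifold R n m)
    (tr : fibre_law F) :=
  isSubBaseTopological.Build (bundle tr)
    [set B : set (bundle tr) | exists (c : fchart F)
       (O : set (coord_space R n m)),
       open O /\ B = [set q | fdom c (base q) /\ O (coords c q)]]
    id.

Definition submanifold (R : realType) (n m : nat) (F : fibred_manifold R n m)
    (tr : fibre_law F) (S : set (bundle tr)) : Prop :=
  forall c : fchart F,
    embedded_submanifold (coords c @` (S `&` [set q | fdom c (base q)])).

(* Coordinate vectors d/dx^lambda, d/dy^i and d/dy^i_lambda (or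
   d/dp^lambda_i). *)
Definition dx (R : realType) (n m : nat) (lam : 'I_n) : coord_space R n m :=
  ((delta_mx 0 lam, 0), 0).
Definition dy (R : realType) (n m : nat) (i : 'I_m) : coord_space R n m :=
  ((0, delta_mx 0 i), 0).
Definition dv (R : realType) (n m : nat) (lam : 'I_n) (i : 'I_m) :
  coord_space R n m := ((0, 0), delta_mx lam i).

(* A smooth horizontal density d c (x, y, v) dx^1 /\ ... /\ dx^n on a bundle
   over Y, by its coefficients in the fibred charts. *)
Record density (R : realType) (n m : nat) (F : fibred_manifold R n m)
    (tr : fibre_law F) := Density {
  dens :> fchart F -> coord_space R n m -> R;
  dens_smooth : forall c,
    smooth_on [set e | cimg (tchart c) e.1] (dens c : _ -> R^o);
  dens_law : forall c c' y v, fdom c y -> fdom c' y ->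
    dens c' (cmap (tchart c') y, tr c c' y v) =
    \det (jacX c' c y) * dens c (cmap (tchart c) y, v)
}.

Definition lagrangian (R : realType) (n m : nat) (F : fibred_manifold R n m) :=
  density (@jet_law _ _ _ F).

(* Smooth sections s of Y -> X, and of a bundle over Y seen as a bundle
   over X. *)
Definition is_section (R : realType) (n m : nat) (F : fibred_manifold R n m)
    (s : fX F -> fY F) : Prop :=
  smooth_map s /\ forall x, fproj (s x) = x.

Definition is_bundle_section (R : realType) (n m : nat)
    (F : fibred_manifold R n m) (tr : fibre_law F) (s : fX F -> bundle tr) :
    Prop :=
  is_section (fun x => base (s x)) /\
  forall c : fchart F,
    smooth_on (cmap (bchart c) @`
                 (cdom (bchart c) `&` [set x | fdom c (base (s x))]))
      (fun e => fcoord (s (cinv (bchart c) e)) c).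

(* Local expressions, as functions of the base coordinates e = (x^lambda), of
   s^i for a section s of Y -> X, and of s^i_lambda or r^lambda_i for a section
   of J^1Y -> X or of Pi -> X. *)
Definition loc (R : realType) (n m : nat) (F : fibred_manifold R n m)
    (c : fchart F) (s : fX F -> fY F) (i : 'I_m) (e : 'rV[R]_n) : R^o :=
  (cmap (tchart c) (s (cinv (bchart c) e))).2 0 i.

Definition floc (R : realType) (n m : nat) (F : fibred_manifold R n m)
    (tr : fibre_law F) (c : fchart F) (s : fX F -> bundle tr) (lam : 'I_n)
    (i : 'I_m) (e : 'rV[R]_n) : R^o :=
  fcoord (s (cinv (bchart c) e)) c lam i.

(* Coordinates of J^1 s. *)
Definition jet_loc (R : realType) (n m : nat) (F : fibred_manifold R n m)
    (c : fchart F) (s : fX F -> fY F) (e : 'rV[R]_n) : coord_space R n m :=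
  (cmap (tchart c) (s (cinv (bchart c) e)),
   \matrix_(lam, i) 'D_(delta_mx 0 lam) (loc c s i) e).

(* sbar = J^1 s *)
Definition is_jet_prolongation (R : realType) (n m : nat)
    (F : fibred_manifold R n m) (s : fX F -> fY F) (sbar : fX F -> jet F) :
    Prop :=
  forall x, base (sbar x) = s x /\
    forall c : fchart F, fdom c (s x) ->
      coords c (sbar x) = jet_loc c s (cmap (bchart c) x).

(* pi^lambda_i = dL / dy^i_lambda *)
Definition momentum (R : realType) (n m : nat) (F : fibred_manifold R n m)
    (L : lagrangian F) (c : fchart F) (lam : 'I_n) (i : 'I_m)
    (z : coord_space R n m) : R^o := 'D_(dv R lam i) (L c : _ -> R^o) z.

Definition is_legendre_morphism (R : realType) (n m : nat)
    (F : fibred_manifold R n m) (L : lagrangian F)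
    (Lhat : jet F -> legendre F) : Prop :=
  forall j, base (Lhat j) = base j /\
    forall c, fdom c (base j) -> forall lam i,
      fcoord (Lhat j) c lam i = momentum L c lam i (coords c j).

(* The constraint space is range Lhat. *)
Definition semiregular (R : realType) (n m : nat) (F : fibred_manifold R n m)
    (Lhat : jet F -> legendre F) : Prop :=
  forall p, range Lhat p ->
    connected (Lhat @^-1` [set p]) /\ submanifold (Lhat @^-1` [set p]).

(* A connection on Y -> X, as a section of J^1Y -> Y. *)
Record connection (R : realType) (n m : nat) (F : fibred_manifold R n m) :=
  Connection {
  conn :> fY F -> jet F;
  conn_base : forall y, base (conn y) = y;
  conn_smooth : forall c : fchart F,
    smooth_on (cimg (tchart c)) (fun z => fcoord (conn (cinv (tchart c) z)) c)
}.

(* A Hamiltonian form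
     p^lam_i dy^i /\ omega_lam - p^lam_i Gamma^i_lam omega - Htilde omega. *)
Record hamiltonian_form (R : realType) (n m : nat) (F : fibred_manifold R n m)
  := HamiltonianForm {
  ham_conn : connection F;
  ham_dens : density (@legendre_law _ _ _ F)
}.

Definition hamiltonian (R : realType) (n m : nat) (F : fibred_manifold R n m)
    (H : hamiltonian_form F) (c : fchart F) (z : coord_space R n m) : R^o :=
  \sum_lam \sum_i z.2 lam i *
    fcoord (ham_conn H (cinv (tchart c) z.1)) c lam i + ham_dens H c z.

(* Exterior n-forms on Pi at a point, as functions of n tangent vectors. *)
Definition omega (R : realType) (n m : nat) (v : 'I_n -> coord_space R n m) :
    R :=
  \det (\matrix_(k, mu) (v k).1.1 0 mu).

(* dy^i /\ (d_lam _| omega) = dx^1 /\ ... /\ dy^i /\ ... /\ dx^n with dy^i at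
   the place of dx^lam. *)
Definition dy_omega (R : realType) (n m : nat) (i : 'I_m) (lam : 'I_n)
    (v : 'I_n -> coord_space R n m) : R :=
  \det (\matrix_(k, mu)
    (if mu == lam then (v k).1.2 0 i else (v k).1.1 0 mu)).

(* p^lam_i dy^i /\ omega_lam - h omega, at the fibre coordinates p. *)
Definition pdy_form (R : realType) (n m : nat) (p : 'M[R]_(n, m)) (h : R)
    (v : 'I_n -> coord_space R n m) : R :=
  \sum_lam \sum_i p lam i * dy_omega i lam v - h * omega v.

Definition ham_form (R : realType) (n m : nat) (F : fibred_manifold R n m)
    (H : hamiltonian_form F) (c : fchart F) (q : legendre F) :
    ('I_n -> coord_space R n m) -> R :=
  pdy_form (fcoord q c) (hamiltonian H c (coords c q)).

(* H_Phi = p^lam_i dy^i /\ omega_lam - p^lam_i Phi^i_lam omega *)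
Definition morphism_form (R : realType) (n m : nat) (F : fibred_manifold R n m)
    (Phi : legendre F -> jet F) (c : fchart F) (q : legendre F) :
    ('I_n -> coord_space R n m) -> R :=
  pdy_form (fcoord q c)
    (\sum_lam \sum_i fcoord q c lam i * fcoord (Phi q) c lam i).

Definition is_momentum_morphism (R : realType) (n m : nat)
    (F : fibred_manifold R n m) (H : hamiltonian_form F)
    (Hhat : legendre F -> jet F) : Prop :=
  forall q, base (Hhat q) = base q /\
    forall c, fdom c (base q) -> forall lam i,
      fcoord (Hhat q) c lam i = 'D_(dv R lam i) (hamiltonian H c) (coords c q).

Definition associated (R : realType) (n m : nat) (F : fibred_manifold R n m)
    (L : lagrangian F) (Lhat : jet F -> legendre F) (H : hamiltonian_form F)
    (Hhat : legendre F -> jet F) : Prop :=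
  (forall q, range Lhat q -> Lhat (Hhat q) = q) /\
  (forall q c v, fdom c (base q) ->
     ham_form H c q v =
     morphism_form Hhat c q v + L c (coords c (Hhat q)) * omega v).

Definition hamilton_equations (R : realType) (n m : nat)
    (F : fibred_manifold R n m) (H : hamiltonian_form F)
    (r : fX F -> legendre F) : Prop :=
  forall (c : fchart F) (x : fX F), fdom c (base (r x)) ->
    let e := cmap (bchart c) x in
    (forall lam i,
       'D_(delta_mx 0 lam) (loc c (fun x => base (r x)) i) e =
       'D_(dv R lam i) (hamiltonian H c) (coords c (r x))) /\
    (forall i,
       \sum_lam 'D_(delta_mx 0 lam) (floc c r lam i) e =
       - 'D_(dy R n i) (hamiltonian H c) (coords c (r x))).

Definition euler_lagrange1 (R : realType) (n m : nat)
    (F : fibred_manifold R n m) (L : lagrangian F) (sbar : fX F -> jet F) :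
    Prop :=
  forall (c : fchart F) (x : fX F), fdom c (base (sbar x)) ->
    let e := cmap (bchart c) x in
    let z := coords c (sbar x) in
    (forall lam i,
       'D_(delta_mx 0 lam) (loc c (fun x => base (sbar x)) i) e =
       fcoord (sbar x) c lam i) /\
    (forall i,
       'D_(dy R n i) (L c : _ -> R^o) z -
       \sum_lam ('D_(dx R m lam) (momentum L c lam i) z +
         \sum_j fcoord (sbar x) c lam j *
           'D_(dy R n j) (momentum L c lam i) z +
         \sum_j \sum_mu 'D_(delta_mx 0 lam) (floc c sbar mu j) e *
           'D_(dv R mu j) (momentum L c lam i) z) = 0).

Definition euler_lagrange2 (R : realType) (n m : nat)
    (F : fibred_manifold R n m) (L : lagrangian F) (s : fX F -> fY F) : Prop :=
  forall (c : fchart F) (x : fX F), fdom c (s x) ->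
    let e := cmap (bchart c) x in
    forall i,
      'D_(dy R n i) (L c : _ -> R^o) (jet_loc c s e) -
      \sum_lam 'D_(delta_mx 0 lam)
        (fun e => momentum L c lam i (jet_loc c s e)) e = 0.

(* Main.v *)
From HB Require Import structures.
Require Import Defs.
From mathcomp Require Import all_boot all_order all_algebra.
From mathcomp Require Import all_classical all_reals all_analysis.

(* In fibred coordinates, "H is associated with L" says that the Hamiltonian is
   the Legendre transform  h = p.v - L(x, y, v),  v = dh/dp.  This holds on an
   open set, because the transition law of Pi is a cocycle, so that every
   coordinate triple comes from a point of Pi.  Differentiating it with respect
   to y, the terms containing dv/dy have the factor p - dL/dv, which vanishes on
   Q; hence dh/dy = - dL/dy at p in Q, where v = Hhat(p).  If sbar and r
   correspond to each other under Lhat and Hhat, then r^lam_i is dL/dy^i_lam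
   along sbar, and the chain rule turns its divergence into the total derivative
   in the Euler-Lagrange equations, using d_lam s^i = sbar^i_lam; so the first
   order Euler-Lagrange equations for sbar and the Hamilton equations for r are
   equivalent. *)

Set Implicit Arguments.
Unset Strict Implicit.
Unset Printing Implicit Defensive.
Import Order.TTheory GRing.Theory Num.Theory.
Import numFieldNormedType.Exports.
Local Open Scope classical_set_scope.
Local Open Scope ring_scope.

(** * Differential calculus *)

Section DifferentialCalculus.
Variable R : realType.
Implicit Types V W : normedModType R.

(** The first order expansion of [f] at [x] is also one of [g], because the remainder is only tested
    near 0; its linear part is continuous, so uniqueness identifies it with the differential of
    [g]. *)
Lemma near_differentiable V W (f g : V -> W) (x : V) :
  {near x, f =1 g} -> differentiable f x -> differentiable g x.
Proof.
move=> fg /diff_locallyP [dfc dfe].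
have gx : f x = g x by apply: (nbhs_singleton fg).
have dge : g \o shift x = cst (g x) + 'd f x +o_ 0 id.
  apply/eqaddoP => e e0; move/eqaddoP: dfe => /(_ e e0).
  apply: filter_app.
  have : \forall y \near 0, (f \o shift x) y = (g \o shift x) y.
    move: fg; rewrite (near_shift 0) /=.
    by apply: filterS => y; rewrite /= subr0.
  by apply: filterS => y /= e1; rewrite !fctE /= e1 /cst gx.
by apply/diff_locallyP; rewrite (diff_unique dfc dge).
Qed.

Lemma is_diff_linear V W (A : V -> W) :
  linear A -> continuous A -> forall x, is_diff x A A.
Proof.
move=> lA cA x.
pose AM := GRing.isLinear.Build _ _ _ _ _ lA.
pose AL : {linear V -> W} := HB.pack A AM.
split; first exact: (@linear_differentiable _ _ _ AL).
by rewrite (@diff_lin _ _ _ AL).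
Qed.

Lemma is_diff_coord (p q : nat) (i : 'I_p) (j : 'I_q) (M : 'M[R]_(p, q)) :
  is_diff M (fun N : 'M[R]_(p, q) => N i j : R^o) (fun N => N i j).
Proof.
apply: is_diff_linear; last exact: coord_continuous.
by move=> a u v; rewrite !mxE.
Qed.

Lemma sum_scale_pair V W (I : Type) (r : seq I) (a : I -> R) (u : I -> V * W) :
  \sum_(i <- r) a i *: u i =
  (\sum_(i <- r) a i *: (u i).1, \sum_(i <- r) a i *: (u i).2).
Proof.
by elim: r => [|i r IHr]; rewrite ?big_nil // !big_cons IHr.
Qed.

Lemma is_diff_fst V W (z : V * W) : is_diff z (@fst V W) (@fst V W).
Proof. by apply: is_diff_linear => // z'; exact: cvg_fst. Qed.

Lemma is_diff_snd V W (z : V * W) : is_diff z (@snd V W) (@snd V W).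
Proof. by apply: is_diff_linear => // z'; exact: cvg_snd. Qed.

Lemma derive_comp V W (W' : normedModType R) (f : V -> W) (g : W -> W') x v :
  differentiable f x -> differentiable g (f x) ->
  'D_v (g \o f) x = 'D_('D_v f x) g (f x).
Proof.
move=> df dg; rewrite deriveE; last exact: differentiable_comp.
by rewrite diff_comp //= !deriveE.
Qed.

Lemma derive_linear_comp V W (W' : normedModType R) (f : V -> W) (A : W -> W')
    x v :
  (forall y, is_diff y A A) -> differentiable f x ->
  'D_v (A \o f) x = A ('D_v f x).
Proof. by move=> dA df; rewrite derive_comp // [LHS]deriveE // diff_val. Qed.

Lemma derive_comp_linear V W (W' : normedModType R) (A : V -> W) (g : W -> W')
    x v :
  (forall y, is_diff y A A) -> differentiable g (A x) ->
  'D_v (g \o A) x = 'D_(A v) g (A x).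
Proof. by move=> dA dg; rewrite derive_comp // !deriveE // diff_val. Qed.

Lemma derive_sum_dir V W (I : Type) (r : seq I) (a : I -> R) (u : I -> V)
    (g : V -> W) x v :
  v = \sum_(i <- r) a i *: u i -> differentiable g x ->
  'D_v g x = \sum_(i <- r) a i *: 'D_(u i) g x.
Proof.
move=> -> dg; rewrite deriveE // linear_sum; apply: eq_bigr => i _.
by rewrite linearZ deriveE.
Qed.

(** Chain rule in coordinates: the vector ['D_v f x] is expanded in the basis [b], and since each
    dual coordinate [l i] is its own differential, its coefficients are the derivatives of
    [l i \o f]. *)
Lemma derive_comp_basis V W (W' : normedModType R) (I : finType) (b : I -> W)
    (l : I -> W -> R) (f : V -> W) (g : W -> W') x v :
  (forall w, w = \sum_i l i w *: b i) -> 
  (forall i w, is_diff w (l i : W -> R^o) (l i : W -> R^o)) ->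
  differentiable f x -> differentiable g (f x) ->
  'D_v (g \o f) x = \sum_i 'D_v (l i \o f : V -> R^o) x *: 'D_(b i) g (f x).
Proof.
move=> bl dl df dg; rewrite derive_comp // (derive_sum_dir (bl ('D_v f x))) //.
by apply: eq_bigr => i _; rewrite derive_linear_comp.
Qed.

(** Differentiability is part of the conclusion so that the lemma can be iterated on double sums. *)
Lemma derive_bigsum V (I : Type) (r : seq I)
    (f : I -> V -> R^o) x v :
  (forall i, differentiable (f i) x) ->
  differentiable (fun z => \sum_(i <- r) f i z) x /\
  'D_v (fun z => \sum_(i <- r) f i z) x = \sum_(i <- r) 'D_v (f i) x.
Proof.
move=> df; elim: r => [|i r [dr Dr]].
  rewrite big_nil (_ : (fun _ => _) = cst 0).
    by rewrite derive_cst; split=> //; exact: differentiable_cst.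
  by apply/funext => z; rewrite big_nil.
rewrite big_cons (_ : (fun _ => _) = f i + (fun z => \sum_(i <- r) f i z)).
  split; first exact: differentiableD.
  by rewrite deriveD ?Dr //; exact: diff_derivable.
by apply/funext => z; rewrite big_cons.
Qed.

(* Stronger than the usual C^k: the derivatives of order [k] are still required
   to be differentiable. *)
Fixpoint Ck V W (k : nat) (U : set V) (f : V -> W) : Prop :=
  (forall x, U x -> differentiable f x) /\
  (if k is k'.+1 then forall v, Ck k' U (fun x => 'D_v f x) else True).

Lemma Ck_differentiable V W k (U : set V) (f : V -> W) x :
  Ck k U f -> U x -> differentiable f x.
Proof. by case: k => [|k] [] df _ /df. Qed.

Lemma CkW V W k (U : set V) (f : V -> W) : Ck k.+1 U f -> Ck k U f.
Proof.
elim: k f => [|k IHk] f [df Df]; split => // v.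
exact: IHk.
Qed.

Lemma Ck_derive V W k (U : set V) (f : V -> W) v :
  Ck k.+1 U f -> Ck k U (fun x => 'D_v f x).
Proof. by case=> _; apply. Qed.

Lemma iter_derive_rcons V W vs v (f : V -> W) :
  iter_derive (rcons vs v) f = iter_derive vs (fun x => 'D_v f x).
Proof. by elim: vs => //= w vs ->. Qed.

(** [iter_derive] adds new derivatives on the outside, whereas [Ck] differentiates [f] itself first;
    induction on a list of directions from its right end reconciles the two. *)
Lemma smooth_onP V W (U : set V) (f : V -> W) :
  smooth_on U f <-> forall k, Ck k U f.
Proof.
split=> [sf k|Cf vs].
  elim: k f sf => [|k IHk] f sf;
    (split=> [x Ux|]; first exact: (sf [::])) => // v.
  by apply: IHk => vs x Ux; rewrite -iter_derive_rcons; apply: sf.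
have {Cf} := Cf (size vs).
elim/last_ind: vs f => [f [] //|vs v IHvs f].
by rewrite size_rcons iter_derive_rcons => -[_ /(_ v)]; apply: IHvs.
Qed.

Section OpenSet.
Variables (V : normedModType R) (U : set V).
Hypothesis Uopen : open U.

(** As [U] is open, functions equal on [U] agree near each of its points, and so do their
    derivatives. This lets the inductions below use derivative formulas that hold on [U] only. *)
Lemma Ck_eq W k (f g : V -> W) :
  (forall x, U x -> f x = g x) -> Ck k U f -> Ck k U g.
Proof.
have nearfg W' (f' g' : V -> W') x : (forall y, U y -> f' y = g' y) -> U x ->
    {near x, f' =1 g'}.
  by move=> fg Ux; apply: filterS fg _; apply: open_nbhs_nbhs.
elim: k f g => [|k IHk] f g fg [df Df];
  (split=> [x Ux|];
    first exact: near_differentiable (nearfg _ _ _ _ fg Ux) (df _ Ux)) => // v.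
apply: IHk (Df v) => x Ux; exact/near_eq_derive/nearfg.
Qed.

Lemma Ck_cst W k (a : W) : Ck k U (cst a).
Proof.
elim: k a => [|k IHk] a; split => // v.
by rewrite (_ : (fun _ => _) = cst 0) //; apply/funext => x; rewrite derive_cst.
Qed.

Lemma CkD W k (f g : V -> W) : Ck k U f -> Ck k U g -> Ck k U (f + g).
Proof.
elim: k f g => [|k IHk] f g [df Df] [dg Dg];
  (split=> [x Ux|];
    first by apply: differentiableD; [apply: df|apply: dg]) => // v.
apply: Ck_eq (IHk _ _ (Df v) (Dg v)) => x Ux.
by rewrite deriveD //; apply/diff_derivable; [apply: df|apply: dg].
Qed.

Lemma Ck_sum W k (I : Type) (r : seq I) (f : I -> V -> W) :
  (forall i, Ck k U (f i)) -> Ck k U (fun x => \sum_(i <- r) f i x).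
Proof.
move=> Cf; elim: r => [|i r IHr].
  rewrite (_ : (fun _ => _) = cst 0); first exact: Ck_cst.
  by apply/funext => x; rewrite big_nil.
rewrite (_ : (fun _ => _) = f i + (fun x => \sum_(i <- r) f i x)).
  exact: CkD.
by apply/funext => x; rewrite big_cons.
Qed.

Lemma CkM k (f g : V -> R^o) :
  Ck k U f -> Ck k U g -> Ck k U (fun x => f x * g x : R^o).
Proof.
elim: k f g => [|k IHk] f g Cf Cg.
  split => // x Ux.
  apply: differentiableM;
    [exact: Ck_differentiable Cf Ux|exact: Ck_differentiable Cg Ux].
split=> [x Ux|v].
  apply: differentiableM;
    [exact: Ck_differentiable Cf Ux|exact: Ck_differentiable Cg Ux].
apply: (@Ck_eq _ _ (fun x => f x * 'D_v g x + g x * 'D_v f x)) => [x Ux|].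
  have df : derivable f x v by exact: diff_derivable (Ck_differentiable Cf Ux).
  have dg : derivable g x v by exact: diff_derivable (Ck_differentiable Cg Ux).
  by rewrite -(deriveM df dg).
by apply: CkD; apply: IHk; [exact: CkW|exact: Cg.2|exact: CkW|exact: Cf.2].
Qed.

Lemma Ck_linear_comp W (W' : normedModType R) k (A : W -> W') (f : V -> W) :
  (forall y, is_diff y A A) -> Ck k U f -> Ck k U (A \o f).
Proof.
move=> dA; elim: k f => [|k IHk] f Cf.
  split => // x Ux; apply: differentiable_comp => //.
  exact: Ck_differentiable Cf Ux.
split=> [x Ux|v].
  by apply: differentiable_comp => //; exact: Ck_differentiable Cf Ux.
apply: Ck_eq (IHk _ (Cf.2 v)) => x Ux /=.
by rewrite derive_linear_comp //; exact: Ck_differentiable Cf Ux.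
Qed.

Lemma Ck_is_diff W k (A : V -> W) : (forall y, is_diff y A A) -> Ck k U A.
Proof.
move=> dA; case: k => [|k]; split=> // v.
apply: (Ck_eq (f := cst (A v))) (Ck_cst _ _) => x Ux.
by rewrite deriveE // diff_val.
Qed.

Lemma Ck_scale W k (f : V -> R^o) (a : W) :
  Ck k U f -> Ck k U (fun x => f x *: a).
Proof.
have dA (y : R^o) : is_diff y (fun c : R^o => c *: a) (fun c => c *: a).
  exact: is_diff_scalel.
exact: (Ck_linear_comp dA).
Qed.

(** In the chain rule the direction in which [g] is differentiated varies with the point. Expanding
    it in the finite basis [b] leaves constant directions, so the derivative is a sum of products
    and the induction, with [g] general, applies to each ['D_(b i) g]. *)
Lemma Ck_comp W k (I : finType) (b : I -> W) (l : I -> W -> R^o)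
    (O : set W) (f : V -> W) (g : W -> R^o) :
  (forall w, w = \sum_i l i w *: b i) ->
  (forall i w, is_diff w (l i) (l i)) ->
  (forall x, U x -> O (f x)) -> Ck k U f -> Ck k O g -> Ck k U (g \o f).
Proof.
move=> bl dl fUO; elim: k g => [|k IHk] g Cf Cg.
  split => // x Ux.
  by apply: differentiable_comp;
      [exact: Ck_differentiable Cf Ux|exact: Ck_differentiable Cg (fUO _ Ux)].
split=> [x Ux|v].
  by apply: differentiable_comp;
      [exact: Ck_differentiable Cf Ux|exact: Ck_differentiable Cg (fUO _ Ux)].
apply: (@Ck_eq _ _ (fun x => \sum_i
    ('D_v (l i \o f) x * 'D_(b i) g (f x) : R^o))) => [x Ux|].
  by rewrite (derive_comp_basis _ bl dl) //;
    [exact: Ck_differentiable Cf Ux|exact: Ck_differentiable Cg (fUO _ Ux)].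
apply: Ck_sum => i; apply: CkM.
  by have [_] := Ck_linear_comp (dl i) Cf; apply.
exact: IHk (CkW Cf) (Cg.2 _).
Qed.

Lemma Ck_pair W (W' : normedModType R) k (f : V -> W) (g : V -> W') :
  Ck k U f -> Ck k U g -> Ck k U (fun x => (f x, g x)).
Proof.
elim: k f g => [|k IHk] f g Cf Cg.
  split => // x Ux.
  apply: differentiable_pair;
    [exact: Ck_differentiable Cf Ux|exact: Ck_differentiable Cg Ux].
split=> [x Ux|v].
  apply: differentiable_pair;
    [exact: Ck_differentiable Cf Ux|exact: Ck_differentiable Cg Ux].
apply: Ck_eq (IHk _ _ (Cf.2 v) (Cg.2 v)) => x Ux.
have df : differentiable f x by exact: Ck_differentiable Cf Ux.
have dg : differentiable g x by exact: Ck_differentiable Cg Ux.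
by rewrite !deriveE //; [rewrite diff_pair|apply: differentiable_pair].
Qed.

Lemma Ck_matrix (p q k : nat) (f : V -> 'M[R]_(p, q)) :
  (forall i j, Ck k U (fun x => f x i j : R^o)) -> Ck k U f.
Proof.
move=> Cf.
apply: (@Ck_eq _ _ (fun x => \sum_i \sum_j f x i j *: delta_mx i j)).
  by move=> x _; rewrite -matrix_sum_delta.
by do 2![apply: Ck_sum => ?]; apply: Ck_scale.
Qed.

End OpenSet.

(** Here the inner derivative is the constant direction [A v], so the induction goes through without
    a basis. *)
Lemma Ck_comp_linear V (V' W : normedModType R) k (U : set V) (A : V' -> V)
    (f : V -> W) :
  open (A @^-1` U) ->
  (forall y, is_diff y A A) -> Ck k U f -> Ck k (A @^-1` U) (f \o A).
Proof.
move=> oA dA; elim: k f => [|k IHk] f Cf.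
  split => // x Ux; apply: differentiable_comp => //.
  exact: Ck_differentiable Cf Ux.
split=> [x Ux|v].
  by apply: differentiable_comp => //; exact: Ck_differentiable Cf Ux.
apply: Ck_eq (IHk _ (Cf.2 (A v))) => // x Ux /=.
by rewrite derive_comp_linear //; exact: Ck_differentiable Cf Ux.
Qed.

End DifferentialCalculus.

(** * Charts and points of the Legendre bundle *)

Section Charts.
Variables (R : realType) (E : normedModType R) (M : manifold E).
Implicit Types c : chart M E.

Lemma cdom_cinv c e : cimg c e -> cdom c (cinv c e).
Proof. by case=> p cp <-; rewrite cmapK. Qed.

Lemma cinvK c e : cimg c e -> cmap c (cinv c e) = e.
Proof. by case=> p cp <-; rewrite cmapK. Qed.

Lemma cimg_cmap c p : cdom c p -> cimg c (cmap c p).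
Proof. by move=> cp; exists p. Qed.

(** Inside the open set [cimg c] the image is the preimage of [O] under the continuous inverse
    [cinv c]. *)
Lemma chart_image_open c (O : set M) :
  open O -> open (cmap c @` (cdom c `&` O)).
Proof.
move=> oO; rewrite openE => _ [p [cp Op] <-].
have ce : cimg c (cmap c p) := cimg_cmap cp.
have nO : nbhs (cmap c p) (cinv c @^-1` O).
  by apply: (cinv_continuous ce); rewrite cmapK //; apply: open_nbhs_nbhs.
have ncimg : nbhs (cmap c p) (cimg c).
  by apply: open_nbhs_nbhs; split => //; exact: cimg_open.
apply: filterS2 nO ncimg => e Oe eimg; exists (cinv c e); last exact: cinvK.
by split => //; apply: cdom_cinv.
Qed.

Lemma chart_nbhs c (O : set M) p : open O -> cdom c p -> O p ->
  \forall e \near cmap c p, cimg c e /\ O (cinv c e).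
Proof.
move=> oO cp Op; have : nbhs (cmap c p) (cmap c @` (cdom c `&` O)).
  apply: open_nbhs_nbhs; split; first exact: chart_image_open.
  by exists p.
by apply: filterS => _ [q [cq Oq] <-]; rewrite cmapK //; split=> //; exists q.
Qed.

Lemma transition_differentiable c c' p : atlas c -> atlas c' ->
  cdom c p -> cdom c' p -> differentiable (cmap c' \o cinv c) (cmap c p).
Proof.
move=> ac ac' cp c'p; apply: (atlas_compatible ac ac' [::]).
by exists p.
Qed.

(** The transition from [c] to [c''] factors through [c'] only near [cmap c p], where [cinv c] takes
    values in the domain of [c']; this is enough for the chain rule at the point. *)
Lemma derive_transition c c' c'' p v : atlas c -> atlas c' -> atlas c'' ->
  cdom c p -> cdom c' p -> cdom c'' p ->
  'D_v (cmap c'' \o cinv c) (cmap c p) =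
  'D_('D_v (cmap c' \o cinv c) (cmap c p)) (cmap c'' \o cinv c') (cmap c' p).
Proof.
move=> ac ac' ac'' cp c'p c''p.
have ndom : {near cmap c p, cmap c'' \o cinv c =1
    (cmap c'' \o cinv c') \o (cmap c' \o cinv c)}.
  apply: filterS (chart_nbhs (cdom_open c') cp c'p) => e [_ c'e] /=.
  by rewrite [cinv c' _]cmapK.
rewrite (near_eq_derive _ ndom) derive_comp /= ?cmapK //.
  exact: transition_differentiable.
exact: transition_differentiable.
Qed.

Lemma derive_transition_refl c p v : cdom c p ->
  'D_v (cmap c \o cinv c) (cmap c p) = v.
Proof.
move=> cp; have nid : {near cmap c p, cmap c \o cinv c =1 id}.
  apply: filterS (chart_nbhs (cdom_open c) cp cp) => e [ce _] /=.
  exact: cinvK.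
by rewrite (near_eq_derive _ nid) derive_id.
Qed.

End Charts.

(** * Cocycle identities for the Jacobians and for the transition law of the Legendre bundle *)

Section FibredCharts.
Variables (R : realType) (n m : nat) (F : fibred_manifold R n m).
Implicit Types c : fchart F.

Lemma jacX_comp c c' c'' y : fdom c y -> fdom c' y -> fdom c'' y ->
  jacX c c'' y = jacX c c' y *m jacX c' c'' y.
Proof.
move=> cy c'y c''y; apply/matrixP => mu lam; rewrite !mxE.
have bc := @bchart_atlas _ _ _ F.
rewrite (derive_transition _ (bc c) (bc c') (bc c'')); try exact: fchart_dom.
set w : 'rV[R]_n := 'D_ _ (_ \o cinv (bchart c)) _.
have dt : differentiable (cmap (bchart c'') \o cinv (bchart c'))
    (cmap (bchart c') (fproj y)).
  by apply: transition_differentiable => //; exact: fchart_dom.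
rewrite (derive_sum_dir (V := 'rV[R]_n) (row_sum_delta w) dt).
by rewrite summxE; apply: eq_bigr => nu _; rewrite !mxE.
Qed.

Lemma jacX_refl c y : fdom c y -> jacX c c y = 1%:M.
Proof.
move=> cy; apply/matrixP => mu lam; rewrite !mxE.
by rewrite derive_transition_refl ?mxE ?eqxx // 1?eq_sym //; exact: fchart_dom.
Qed.

(** The new base coordinates depend on the old base coordinates alone, so they do not vary in a
    vertical direction. *)
Lemma derive_vertical c c' y w : fdom c y -> fdom c' y ->
  ('D_((0, w) : 'rV[R]_n * 'rV[R]_m)
     (cmap (tchart c') \o cinv (tchart c)) (cmap (tchart c) y)).1 = 0.
Proof.
move=> cy c'y.
have tc := @tchart_atlas _ _ _ F; have bc := @bchart_atlas _ _ _ F.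
rewrite -(derive_linear_comp _ (@is_diff_fst _ _ _)); last first.
  exact: transition_differentiable.
have nb : {near cmap (tchart c) y, fst \o (cmap (tchart c') \o cinv (tchart c))
    =1 (cmap (bchart c') \o cinv (bchart c)) \o fst}.
  apply: filterS (chart_nbhs (cdom_open (tchart c')) cy c'y) => e [ce c'e] /=.
  rewrite (fchart_proj c'e) -{2}(cinvK ce) fchart_proj ?cmapK //.
    exact/fchart_dom/cdom_cinv.
  exact: cdom_cinv.
rewrite (near_eq_derive _ nb) (derive_comp_linear _ (@is_diff_fst _ _ _)) /=.
  by rewrite derive0.
rewrite fchart_proj //; apply: transition_differentiable => //;
  exact: fchart_dom.
Qed.

Lemma jacY_comp c c' c'' y : fdom c y -> fdom c' y -> fdom c'' y ->
  jacY c c'' y = jacY c c' y *m jacY c' c'' y.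
Proof.
move=> cy c'y c''y; apply/matrixP => j i; have tc := @tchart_atlas _ _ _ F.
rewrite !mxE (derive_transition _ (tc c) (tc c') (tc c'')) //.
set w : 'rV[R]_n * 'rV[R]_m := 'D_ _ (_ \o cinv (tchart c)) _.
(* The first transition maps a vertical vector to a vertical one, so no [jacXY] term enters; the
   coefficients are a row of [jacY c c' y]. *)
have w_sum : w = \sum_k w.2 0 k *: ((0, delta_mx 0 k) : 'rV[R]_n * 'rV[R]_m).
  rewrite [LHS]surjective_pairing (derive_vertical _ cy c'y) -/w.
  rewrite {1}(row_sum_delta w.2) sum_scale_pair; congr pair.
  by rewrite big1 // => k _; rewrite scaler0.
have jE k : jacY c c' y j k = w.2 0 k by rewrite mxE.
have dt : differentiable (cmap (tchart c'') \o cinv (tchart c'))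
    (cmap (tchart c') y) by exact: transition_differentiable.
have scaleE (a : R) (u : 'rV[R]_m) b : u 0 i = b -> (a *: u) 0 i = a * b.
  by rewrite mxE => ->.
rewrite (derive_sum_dir w_sum dt) sum_scale_pair summxE.
apply: eq_bigr => k _; apply: (etrans (scaleE _ _ (jacY c' c'' y k i) _)).
  by apply/esym; rewrite /jacY mxE.
exact/(congr1 ( *%R^~ _))/esym/jE.
Qed.

Lemma jacY_refl c y : fdom c y -> jacY c c y = 1%:M.
Proof.
move=> cy; apply/matrixP => j i; rewrite !mxE.
by rewrite derive_transition_refl //= mxE eqxx /= eq_sym.
Qed.

(** Transposition reverses the Jacobian products, which puts the factors of the second change of
    chart outside those of the first; the determinant is multiplicative. *)
Lemma legendre_law_comp c c' c'' y p :
  fdom c y -> fdom c' y -> fdom c'' y ->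
  legendre_law c c'' y p = legendre_law c' c'' y (legendre_law c c' y p).
Proof.
move=> cy c'y c''y; rewrite /legendre_law.
rewrite (jacX_comp c''y c'y cy) (jacX_comp cy c'y c''y) (jacY_comp c''y c'y cy).
by rewrite det_mulmx !trmx_mul -!scalemxAr -scalemxAl scalerA !mulmxA.
Qed.

Lemma legendre_law_refl c y p : fdom c y -> legendre_law c c y p = p.
Proof.
move=> cy; rewrite /legendre_law jacX_refl // jacY_refl //.
by rewrite det1 scale1r !trmx1 mul1mx mulmx1.
Qed.

(** The matrix [p] is carried from [c] to every other chart at [y]. The cocycle identity makes the
    family compatible, and the trivial change of chart gives back [p] in [c]. *)
Lemma legendre_point c y p : fdom c y ->
  exists q : legendre F, base q = y /\ fcoord q c = p.
Proof.
move=> cy.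
pose fc c' := if `[< fdom c' y >] then legendre_law c c' y p else 0.
have fcT c' : fdom c' y -> fc c' = legendre_law c c' y p.
  by rewrite /fc => /asboolP ->.
have fc_law c' c'' : fdom c' y -> fdom c'' y ->
    fc c'' = legendre_law c' c'' y (fc c').
  move=> c'y c''y; rewrite (fcT _ c'y) (fcT _ c''y).
  exact: legendre_law_comp.
have fc_out c' : ~ fdom c' y -> fc c' = 0.
  by rewrite /fc; case: asboolP.
exists (BundlePoint fc_law fc_out); split=> //=.
by rewrite fcT // legendre_law_refl.
Qed.

(** Through this, an identity known at all points of the bundle becomes one between functions on an
    open set of [coord_space], where it can be differentiated. *)
Lemma legendre_coords c (z : coord_space R n m) : cimg (tchart c) z.1 ->
  exists q : legendre F, fdom c (base q) /\ coords c q = z.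
Proof.
move=> cz; have cy := cdom_cinv cz.
have [q [qy qp]] := legendre_point z.2 cy.
exists q; rewrite /fdom /coords qy qp; split=> //.
by rewrite cinvK // -surjective_pairing.
Qed.

End FibredCharts.

(** * The Legendre transform in coordinates *)

Section CoordinateSpace.
Variables (R : realType) (n m : nat).

(** The standard basis, indexed by the three kinds of coordinates; with the dual family [coord_fun]
    it is the basis to which [derive_comp_basis] and [Ck_comp] are applied. *)
Definition coord_basis (k : 'I_n + 'I_m + 'I_n * 'I_m) : coord_space R n m :=
  match k with
  | inl (inl lam) => dx R m lam
  | inl (inr i) => dy R n i
  | inr (lam, i) => dv R lam i
  end.

Definition coord_fun (k : 'I_n + 'I_m + 'I_n * 'I_m) (z : coord_space R n m) :
    R^o :=
  match k with
  | inl (inl lam) => z.1.1 0 lam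
  | inl (inr i) => z.1.2 0 i
  | inr (lam, i) => z.2 lam i
  end.

Lemma coord_decomposition z : z = \sum_k coord_fun k z *: coord_basis k.
Proof.
case: z => [[x y] p]; rewrite big_sumType big_sumType /=.
rewrite !sum_scale_pair /=.
have sum0 (V : normedModType R) (I : finType) (a : I -> R) (u : I -> V) :
    (forall i, u i = 0) -> \sum_i a i *: u i = 0.
  by move=> u0; rewrite big1 // => i _; rewrite u0 scaler0.
have -> : \sum_(k : 'I_n * 'I_m) (let (lam, i) := k in p lam i) *:
    (let (lam, i) := k in dv R lam i).2 = p.
  by rewrite [RHS]matrix_sum_delta pair_big; apply: eq_bigr => -[].
rewrite -(row_sum_delta x) -(row_sum_delta y).
rewrite !sum0; do ?[by []|by case].
by congr (_, _, _); rewrite /= ?addr0 ?add0r.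
Qed.

Lemma is_diff_coord_fun k z : is_diff z (coord_fun k) (coord_fun k).
Proof.
case: k => [[lam|i]|[lam i]].
- exact: (is_diff_comp (is_diff_comp (is_diff_fst z) (is_diff_fst _))
    (is_diff_coord 0 lam _)).
- exact: (is_diff_comp (is_diff_comp (is_diff_fst z) (is_diff_snd _))
    (is_diff_coord 0 i _)).
- exact: (is_diff_comp (is_diff_snd z) (is_diff_coord lam i _)).
Qed.

Lemma derive_coord_fun k z v : 'D_v (coord_fun k) z = coord_fun k v.
Proof.
have dk := is_diff_coord_fun k z.
by rewrite deriveE // diff_val.
Qed.

(** The last double sum runs over [i] first, as in the Euler-Lagrange equations. *)
Lemma derive_comp_coord (V : normedModType R)
    (f : V -> coord_space R n m) (g : coord_space R n m -> R^o) x v :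
  differentiable f x -> differentiable g (f x) ->
  'D_v (g \o f) x =
  \sum_lam 'D_v (fun e => (f e).1.1 0 lam : R^o) x * 'D_(dx R m lam) g (f x) +
  \sum_i 'D_v (fun e => (f e).1.2 0 i : R^o) x * 'D_(dy R n i) g (f x) +
  \sum_i \sum_lam 'D_v (fun e => (f e).2 lam i : R^o) x *
    'D_(dv R lam i) g (f x).
Proof.
move=> df dg.
rewrite (derive_comp_basis _ coord_decomposition is_diff_coord_fun) //.
rewrite big_sumType big_sumType /=; congr (_ + _).
by rewrite exchange_big pair_big; apply: eq_bigr => -[].
Qed.

Lemma fst_preimage_open (O : set ('rV[R]_n * 'rV[R]_m)) :
  open O -> open [set z : coord_space R n m | O z.1].
Proof. by move=> oO; apply: open_comp => // z _; exact: cvg_fst. Qed.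

(** With [h] the Hamiltonian, this is the momentum morphism in coordinates. *)
Definition legendre_transform_arg (h : coord_space R n m -> R^o)
    (z : coord_space R n m) : coord_space R n m :=
  (z.1, \matrix_(lam, i) 'D_(dv R lam i) h z).

(* Since [L] is evaluated at [dh/dp], the terms containing the second
   derivatives [d^2 h / dy dp] cancel where [dL/dv] inverts [dh/dp]. *)
Lemma legendre_transform_derive_y (O : set ('rV[R]_n * 'rV[R]_m))
    (h L : coord_space R n m -> R^o) z i :
  open O -> Ck 2 [set z | O z.1] h -> Ck 1 [set z | O z.1] L ->
  (forall z, O z.1 -> h z = \sum_lam \sum_j z.2 lam j * 'D_(dv R lam j) h z -
    L (legendre_transform_arg h z)) ->
  O z.1 ->
  (forall lam j, 'D_(dv R lam j) L (legendre_transform_arg h z) = z.2 lam j) ->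
  'D_(dy R n i) h z = - 'D_(dy R n i) L (legendre_transform_arg h z).
Proof.
move=> oO Ch CL hE Oz piE; set W := legendre_transform_arg h.
have oU : open [set z : coord_space R n m | O z.1] := fst_preimage_open oO.
have dW : differentiable W z.
  apply: (@Ck_differentiable _ _ _ 1 [set z | O z.1]) => //.
  apply: (Ck_pair oU); first exact: (Ck_is_diff oU _ (@is_diff_fst _ _ _)).
  apply: (Ck_matrix oU) => lam j.
  by apply: (Ck_eq oU _ (Ck_derive (dv R lam j) Ch)) => e _; rewrite mxE.
have dL : differentiable L (W z) by apply: Ck_differentiable CL _.
pose P lam j : coord_space R n m -> R^o := fun e => 'D_(dv R lam j) h e.
have dP lam j : differentiable (P lam j) z.
  exact: (Ck_differentiable (Ck_derive (dv R lam j) Ch)).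
pose A lam j : coord_space R n m -> R^o := fun e => e.2 lam j * P lam j e.
(* The fibre coordinate [e.2 lam j] is constant along [dy R n i], so one term of the Leibniz rule
   vanishes. *)
have dA lam j : differentiable (A lam j) z /\
    'D_(dy R n i) (A lam j) z = z.2 lam j * 'D_(dy R n i) (P lam j) z.
  have [dc _] := is_diff_coord_fun (inr (lam, j)) z.
  split; first exact: (differentiableM dc (dP lam j)).
  have -> := deriveM (diff_derivable dc) (diff_derivable (dP lam j)).
  by rewrite derive_coord_fun /= mxE scaler0 addr0.
have dAj lam := derive_bigsum (index_enum 'I_m) (dy R n i)
  (fun j => (dA lam j).1).
have [dS DS] := derive_bigsum (index_enum 'I_n) (dy R n i)
  (fun lam => (dAj lam).1).
(* The Legendre identity holds on a whole neighbourhood of [z], hence may be differentiated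
   there. *)
have nh : {near z, h =1 (fun e => \sum_lam \sum_j A lam j e) - (L \o W)}.
  have nU : \forall e \near z, [set e | O e.1] e.
    by apply: open_nbhs_nbhs; split.
  move: nU; apply: filterS => e; exact: hE.
rewrite (near_eq_derive _ nh) deriveB; last 2 first.
  exact: diff_derivable dS.
  exact/diff_derivable/differentiable_comp.
rewrite DS derive_comp_coord //.
(* [W] keeps the coordinates x and y, so of their terms in the chain rule only the one for y^i
   survives. *)
have WX lam : 'D_(dy R n i) (fun e => (W e).1.1 0 lam : R^o) z = 0.
  by have -> := derive_coord_fun (inl (inl lam)) z (dy R n i); rewrite /= mxE.
have WY j : 'D_(dy R n i) (fun e => (W e).1.2 0 j : R^o) z = (j == i)%:R.
  by have -> := derive_coord_fun (inl (inr j)) z (dy R n i); rewrite /= mxE.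
have WP lam j : (fun e => (W e).2 lam j : R^o) = P lam j.
  by apply/funext => e; rewrite mxE.
rewrite [X in _ - (X + _ + _)]big1 => [|lam _]; last by rewrite WX mul0r.
rewrite (bigD1 i) //= WY eqxx mul1r add0r.
rewrite [X in _ - (_ + X + _)]big1 => [|j ji]; last first.
  by rewrite WY (negbTE ji) mul0r.
(* Once - dL/dy^i is split off, what remains is the difference of the sums of p d^2h/dy dp and of
   dL/dv d^2h/dy dp, which agree by [piE]. *)
rewrite addr0 opprD addrCA -[RHS]addr0; congr (_ + _); apply/eqP.
rewrite subr_eq0 [X in _ == X]exchange_big /=; apply/eqP.
apply: eq_bigr => lam _; rewrite (dAj lam).2; apply: eq_bigr => j _.
by rewrite (dA lam j).2 WP piE mulrC.
Qed.

End CoordinateSpace.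

(** * Sections of the jet and Legendre bundles *)

Section Sections.
Variables (R : realType) (n m : nat) (F : fibred_manifold R n m).
Variable tr : fibre_law F.
Implicit Types (c : fchart F) (s : fX F -> bundle tr).

(** Written exactly as the set in [is_bundle_section], to which it is convertible. *)
Definition section_dom c s : set 'rV[R]_n :=
  cmap (bchart c) @` (cdom (bchart c) `&` [set x | fdom c (base (s x))]).

Definition section_coords c s (e : 'rV[R]_n) : coord_space R n m :=
  coords c (s (cinv (bchart c) e)).

Lemma section_dom_open c s : is_bundle_section s -> open (section_dom c s).
Proof.
move=> [[[cs _] _] _]; apply: chart_image_open.
by apply: open_comp; [move=> x _; exact: cs|exact: cdom_open].
Qed.

Lemma section_bchart c s x : is_bundle_section s -> fdom c (base (s x)) ->
  cdom (bchart c) x.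
Proof. by move=> [[_ sK] _] /fchart_dom; rewrite sK. Qed.

Lemma section_dom_cmap c s x : is_bundle_section s -> fdom c (base (s x)) ->
  section_dom c s (cmap (bchart c) x).
Proof.
by move=> hs cx; exists x => //; split=> //; apply: section_bchart cx.
Qed.

Lemma section_coords_cmap c s x : is_bundle_section s -> fdom c (base (s x)) ->
  section_coords c s (cmap (bchart c) x) = coords c (s x).
Proof.
by move=> hs cx; rewrite /section_coords cmapK //; apply: section_bchart cx.
Qed.

Lemma section_coords_cimg c s e : section_dom c s e ->
  cimg (tchart c) (section_coords c s e).1.
Proof.
by move=> [x [bx cx] <-]; rewrite /section_coords cmapK //; exact: cimg_cmap.
Qed.

Lemma section_coords_base c s e : is_bundle_section s -> section_dom c s e ->
  (section_coords c s e).1.1 = e.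
Proof.
move=> [[_ sK] _] [x [bx cx] <-].
by rewrite /section_coords cmapK //= fchart_proj // sK.
Qed.

Lemma section_coords_smooth c s k : is_bundle_section s ->
  Ck k (section_dom c s) (section_coords c s).
Proof.
move=> hs; have oU := section_dom_open (c := c) hs.
case: hs => -[[_ ss] _] fs; apply: (Ck_pair oU).
  by move: k; apply/smooth_onP/(ss _ _ (bchart_atlas c) (tchart_atlas c)).
by move: k; apply/smooth_onP/fs.
Qed.

Lemma section_smooth c s k (g : coord_space R n m -> R^o) :
  is_bundle_section s -> Ck k [set z | cimg (tchart c) z.1] g ->
  Ck k (section_dom c s) (g \o section_coords c s).
Proof.
move=> hs Cg.
have oU := section_dom_open (c := c) hs.
have Cs := section_coords_smooth c k hs.
apply: (Ck_comp (I := _) (b := @coord_basis R n m) (l := @coord_fun R n m)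
  oU _ _ _ Cs Cg).
- exact: coord_decomposition.
- exact: is_diff_coord_fun.
- exact: section_coords_cimg.
Qed.

Lemma near_section_dom c s x : is_bundle_section s -> fdom c (base (s x)) ->
  \forall e \near cmap (bchart c) x, section_dom c s e.
Proof.
move=> hs cx; apply: open_nbhs_nbhs; split; first exact: section_dom_open.
exact: section_dom_cmap.
Qed.

End Sections.

(** * Association of a Hamiltonian form with a Lagrangian, and momenta along a section *)

Section LagrangianHamiltonian.
Variables (R : realType) (n m : nat) (F : fibred_manifold R n m).
Implicit Types (c : fchart F) (L : lagrangian F) (H : hamiltonian_form F).

Lemma chart_preimage_open c :
  open [set z : coord_space R n m | cimg (tchart c) z.1].
Proof. exact/fst_preimage_open/cimg_open. Qed.

Lemma density_Ck (tr : fibre_law F) (d : density tr) c k :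
  Ck k [set z | cimg (tchart c) z.1] (d c : _ -> R^o).
Proof. by move: k; apply/smooth_onP/dens_smooth. Qed.

Lemma momentum_Ck L c k lam i :
  Ck k [set z | cimg (tchart c) z.1] (momentum L c lam i).
Proof. exact/Ck_derive/density_Ck. Qed.

Lemma hamiltonian_Ck H c k :
  Ck k [set z | cimg (tchart c) z.1] (hamiltonian H c).
Proof.
have oU := @chart_preimage_open c.
apply: (CkD oU _ (density_Ck (ham_dens H) c k)).
apply: (Ck_sum oU) => lam; apply: (Ck_sum oU) => i; apply: (CkM oU).
  exact: (Ck_is_diff oU k (is_diff_coord_fun (inr (lam, i)))).
have Cconn : Ck k (cimg (tchart c))
    (fun y => fcoord (ham_conn H (cinv (tchart c) y)) c).
  by move: k; apply/smooth_onP/conn_smooth.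
have oy : open (cimg (tchart c)) := @cimg_open _ _ _ (tchart c).
have Ce := Ck_linear_comp oy (is_diff_coord lam i) Cconn.
exact: (Ck_comp_linear oU (@is_diff_fst _ _ _) Ce).
Qed.

Lemma coords_momentum_morphism H (Hhat : legendre F -> jet F) c q :
  is_momentum_morphism H Hhat -> fdom c (base q) ->
  coords c (Hhat q) = legendre_transform_arg (hamiltonian H c) (coords c q).
Proof.
move=> hH cq; have [bq fq] := hH q.
rewrite /coords /legendre_transform_arg bq; congr pair.
by apply/matrixP => lam i; rewrite fq // mxE.
Qed.

(* Both forms have the same coefficients on [dy^i /\ omega_lam]; the values on
   the vectors [d/dx^lam], where [omega] is 1, give the identity. *)
Lemma associated_hamiltonian L Lhat H Hhat c (z : coord_space R n m) :
  is_momentum_morphism H Hhat -> associated L Lhat H Hhat ->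
  cimg (tchart c) z.1 ->
  hamiltonian H c z =
  \sum_lam \sum_i z.2 lam i * 'D_(dv R lam i) (hamiltonian H c) z -
  L c (legendre_transform_arg (hamiltonian H c) z).
Proof.
move=> hH [_ aH] cz; have [q [cq <-]] := legendre_coords cz.
have := aH q c (@dx R n m) cq.
rewrite /ham_form /morphism_form /pdy_form.
have -> : omega (@dx R n m) = 1.
  rewrite /omega (_ : \matrix_(_, _) _ = 1%:M) ?det1 //.
  by apply/matrixP => k mu; rewrite !mxE eqxx eq_sym.
rewrite !mulr1 -(coords_momentum_morphism hH cq) -addrA => /addrI /eqP.
rewrite eqr_oppLR opprD opprK => /eqP ->; congr (_ - _).
apply: eq_bigr => lam _; apply: eq_bigr => i _.
by rewrite (hH q).2.
Qed.

(** The two relations between [j] and [q] say that p = dL/dv at v = dh/dp, which is the condition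
    for the second derivatives to cancel in the Legendre transform. *)
Lemma hamiltonian_derive_y L Lhat H Hhat c i j q :
  is_legendre_morphism L Lhat ->
  is_momentum_morphism H Hhat -> associated L Lhat H Hhat ->
  Lhat j = q -> Hhat q = j -> fdom c (base q) ->
  'D_(dy R n i) (hamiltonian H c) (coords c q) =
  - 'D_(dy R n i) (L c : _ -> R^o) (coords c j).
Proof.
move=> hL hH aH Ljq Hqj cq.
rewrite -Hqj (coords_momentum_morphism hH cq).
apply: (@legendre_transform_derive_y _ _ _ (cimg (tchart c))).
- exact: cimg_open.
- exact: hamiltonian_Ck.
- exact: density_Ck.
- by move=> z; exact: associated_hamiltonian hH aH.
- exact: cimg_cmap.
- move=> lam k; rewrite -(coords_momentum_morphism hH cq) Hqj.
  have [bj fj] := hL j.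
  by rewrite -[LHS]/(momentum L c lam k (coords c j)) -fj ?Ljq // -bj Ljq.
Qed.

(** The chain rule, where the equations d_lam s^i = sbar^i_lam turn the coefficients of the
    y-derivatives into fibre coordinates: this is the total derivative in the Euler-Lagrange
    equations. *)
Lemma derive_momentum_section L (sbar : fX F -> jet F) c x lam i :
  is_bundle_section sbar -> fdom c (base (sbar x)) ->
  let e := cmap (bchart c) x in
  let z := coords c (sbar x) in
  (forall i, 'D_(delta_mx 0 lam) (loc c (fun x => base (sbar x)) i) e =
    fcoord (sbar x) c lam i) ->
  'D_(delta_mx 0 lam) (momentum L c lam i \o section_coords c sbar) e =
  'D_(dx R m lam) (momentum L c lam i) z +
  \sum_j fcoord (sbar x) c lam j * 'D_(dy R n j) (momentum L c lam i) z +
  \sum_j \sum_mu 'D_(delta_mx 0 lam) (floc c sbar mu j) e *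
    'D_(dv R mu j) (momentum L c lam i) z.
Proof.
move=> hs cx e z jet_eq; have ce := section_dom_cmap hs cx.
have cz : section_coords c sbar e = z by exact: section_coords_cmap.
rewrite derive_comp_coord.
- rewrite cz; congr (_ + _ + _); last first.
    by apply: eq_bigr => j _; rewrite -jet_eq.
  (* The base coordinates of a section at [e] are [e] itself, so a single x-derivative is left. *)
  have xE mu : 'D_(delta_mx 0 lam)
      (fun e => (section_coords c sbar e).1.1 0 mu : R^o) e = (mu == lam)%:R.
    have nx : {near e, (fun e => (section_coords c sbar e).1.1 0 mu : R^o) =1
        (fun e => e 0 mu : R^o)}.
      apply: filterS (near_section_dom hs cx) => e' ce'.
      by rewrite section_coords_base.
    have dc := is_diff_coord 0 mu e.
    by rewrite (near_eq_derive _ nx) deriveE // diff_val mxE.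
  rewrite (bigD1 lam) //= xE eqxx mul1r big1 ?addr0 // => mu mulam.
  by rewrite xE (negbTE mulam) mul0r.
- exact: Ck_differentiable (section_coords_smooth c 0 hs) ce.
- rewrite cz; apply: Ck_differentiable (momentum_Ck L c 0 lam i) _.
  exact: cimg_cmap.
Qed.

End LagrangianHamiltonian.

(** * Lagrangian and Hamiltonian equations *)

Section Correspondence.
Variables (R : realType) (n m : nat) (F : fibred_manifold R n m).
Variables (L : lagrangian F) (Lhat : jet F -> legendre F).
Variables (H : hamiltonian_form F) (Hhat : legendre F -> jet F).
Hypothesis hL : is_legendre_morphism L Lhat.
Hypothesis hH : is_momentum_morphism H Hhat.
Variables (sbar : fX F -> jet F) (r : fX F -> legendre F).
Hypothesis Lsbar : forall x, Lhat (sbar x) = r x.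
Hypothesis Hr : forall x, Hhat (r x) = sbar x.

Lemma base_legendre_section x : base (r x) = base (sbar x).
Proof. by rewrite -Lsbar; have [] := hL (sbar x). Qed.

Lemma base_legendre_sectionE :
  (fun x => base (r x)) = (fun x => base (sbar x)).
Proof. by apply/funext => x; apply: base_legendre_section. Qed.

Lemma floc_legendre_section c lam i e : section_dom c sbar e ->
  floc c r lam i e = (momentum L c lam i \o section_coords c sbar) e.
Proof.
move=> [x [bx cx] <-]; rewrite /floc /section_coords /= cmapK //.
by rewrite -Lsbar (hL (sbar x)).2.
Qed.

Lemma floc_jet_section c lam i e : section_dom c r e ->
  floc c sbar lam i e =
  'D_(dv R lam i) (hamiltonian H c) (section_coords c r e).
Proof.
move=> [x [bx cx] <-]; rewrite /floc /section_coords /= cmapK //.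
by rewrite -Hr (hH (r x)).2.
Qed.

Lemma section_domE c : section_dom c r = section_dom c sbar.
Proof.
congr (_ @` (_ `&` _)); apply/funext => x.
by rewrite /mkset base_legendre_section.
Qed.

(** The fibre coordinates of [sbar] are dh/dp along [r], and h is smooth in each chart. *)
Lemma jet_section_smooth : is_bundle_section r -> is_bundle_section sbar.
Proof.
move=> hr; have [br fr] := hr; split; first by rewrite -base_legendre_sectionE.
move=> c; rewrite -[_ @` _]/(section_dom c sbar) -section_domE.
have oU := section_dom_open (c := c) hr.
apply/smooth_onP => k; apply: (Ck_matrix oU) => lam i.
have Cp := Ck_derive (dv R lam i) (hamiltonian_Ck H c k.+1).
apply: (Ck_eq oU _ (section_smooth hr Cp)) => e ce.
by rewrite [RHS](floc_jet_section lam i ce).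
Qed.

(** The fibre coordinates of [r] are the momenta dL/dv along [sbar]. *)
Lemma legendre_section_smooth : is_bundle_section sbar -> is_bundle_section r.
Proof.
move=> hs; have [bs fs] := hs; split; first by rewrite base_legendre_sectionE.
move=> c; rewrite -[_ @` _]/(section_dom c r) section_domE.
have oU := section_dom_open (c := c) hs.
apply/smooth_onP => k; apply: (Ck_matrix oU) => lam i.
apply: (Ck_eq oU _ (section_smooth hs (momentum_Ck L c k lam i))) => e ce.
by rewrite [RHS](floc_legendre_section lam i ce).
Qed.

Lemma euler_lagrange1_hamilton : associated L Lhat H Hhat ->
  is_bundle_section sbar -> (euler_lagrange1 L sbar <-> hamilton_equations H r).
Proof.
move=> hA hs.
have momentum_eq c x : fdom c (base (sbar x)) ->
    forall lam i, 'D_(dv R lam i) (hamiltonian H c) (coords c (r x)) =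
      fcoord (sbar x) c lam i.
  by move=> cx lam i; rewrite -Hr (hH (r x)).2 // base_legendre_section.
(* The fibre coordinates of [r] equal the momenta along [sbar] on an open set, so their derivatives
   agree too. *)
have divergence c x i : fdom c (base (sbar x)) ->
    \sum_lam 'D_(delta_mx 0 lam) (floc c r lam i) (cmap (bchart c) x) =
    \sum_lam 'D_(delta_mx 0 lam) (momentum L c lam i \o section_coords c sbar)
      (cmap (bchart c) x).
  move=> cx; apply: eq_bigr => lam _; apply: near_eq_derive.
  apply: filterS (near_section_dom hs cx) => e.
  exact: floc_legendre_section.
split=> eqs c x cx e.
- have {}cx : fdom c (base (sbar x)) by rewrite -base_legendre_section.
  have [jet_eq el] := eqs c x cx.
  split=> [lam i|i]; first by rewrite base_legendre_sectionE jet_eq momentum_eq.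
  rewrite divergence // (hamiltonian_derive_y _ hL hH hA (Lsbar x) (Hr x));
    last by rewrite base_legendre_section.
  have := el i; rewrite opprK => /eqP; rewrite subr_eq0 => /eqP ->.
  apply: eq_bigr => lam _.
  by rewrite (derive_momentum_section _ _ hs cx) // => j; exact: jet_eq.
- have rx : fdom c (base (r x)) by rewrite base_legendre_section.
  have [jet_eq el] := eqs c x rx => z.
  have {}jet_eq lam i : 'D_(delta_mx 0 lam) (loc c (fun x => base (sbar x)) i) e
      = fcoord (sbar x) c lam i.
    by rewrite -base_legendre_sectionE jet_eq momentum_eq.
  split=> // i; apply/eqP; rewrite subr_eq0; apply/eqP.
  have := el i; rewrite divergence //.
  rewrite (hamiltonian_derive_y _ hL hH hA (Lsbar x) (Hr x)) // opprK => <-.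
  by apply: eq_bigr => lam _; rewrite (derive_momentum_section _ _ hs cx).
Qed.

End Correspondence.

(** The first group of equations identifies the coordinates of [sbar] with those of the
    prolongation; the second group is then the second order equation, its total derivative being
    that of the momentum along the section. *)
Lemma euler_lagrange1_prolongation (R : realType) (n m : nat)
    (F : fibred_manifold R n m) (L : lagrangian F) (sbar : fX F -> jet F) :
  is_bundle_section sbar -> euler_lagrange1 L sbar ->
  is_jet_prolongation (fun x => base (sbar x)) sbar /\
  euler_lagrange2 L (fun x => base (sbar x)).
Proof.
move=> hs el; have jetE c x : fdom c (base (sbar x)) ->
    coords c (sbar x) =
    jet_loc c (fun x => base (sbar x)) (cmap (bchart c) x).
  move=> cx; have [jet_eq _] := el c x cx.
  rewrite /coords /jet_loc cmapK; last exact: section_bchart hs cx.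
  by congr pair; apply/matrixP => lam i; rewrite mxE jet_eq.
split=> [x|c x cx e i]; first by split=> // c; exact: jetE.
have [jet_eq /(_ i)] := el c x cx.
rewrite -jetE // => /eqP; rewrite subr_eq0 => /eqP ->.
apply/eqP; rewrite subr_eq0; apply/eqP; apply: eq_bigr => lam _.
have dm := @derive_momentum_section _ _ _ _ L sbar c x lam i hs cx (jet_eq lam).
apply: (etrans (esym dm)).
(* [jetE] is used at all nearby points, since the momentum along the prolongation is
   differentiated. *)
apply: near_eq_derive; apply: filterS (near_section_dom hs cx).
move=> _ [x' [bx' cx'] <-]; rewrite /section_coords /= cmapK //.
by rewrite jetE.
Qed.

Theorem proposition10 (R : realType) (n m : nat) (F : fibred_manifold R n m)
  (L : lagrangian F) (Lhat : jet F -> legendre F)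
  (hLhat : is_legendre_morphism L Lhat) (hL : semiregular Lhat) :
  (forall (H : hamiltonian_form F) (Hhat : legendre F -> jet F)
     (r : fX F -> legendre F),
     is_momentum_morphism H Hhat -> associated L Lhat H Hhat ->
     is_bundle_section r -> hamilton_equations H r ->
     (forall x, range Lhat (r x)) ->
     is_bundle_section (Hhat \o r) /\ euler_lagrange1 L (Hhat \o r))
  /\
  (forall (sbar : fX F -> jet F) (H : hamiltonian_form F)
     (Hhat : legendre F -> jet F),
     is_bundle_section sbar -> euler_lagrange1 L sbar ->
     is_momentum_morphism H Hhat -> associated L Lhat H Hhat ->
     Hhat \o Lhat \o sbar = sbar ->
     is_bundle_section (Lhat \o sbar) /\
     hamilton_equations H (Lhat \o sbar) /\
     (forall x, range Lhat ((Lhat \o sbar) x)))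
  /\
  (forall (sbar : fX F -> jet F) (r : fX F -> legendre F),
     (exists (H : hamiltonian_form F) (Hhat : legendre F -> jet F),
        is_momentum_morphism H Hhat /\ associated L Lhat H Hhat /\
        is_bundle_section r /\ hamilton_equations H r /\
        (forall x, range Lhat (r x)) /\ sbar = Hhat \o r)
     \/
     (exists (H : hamiltonian_form F) (Hhat : legendre F -> jet F),
        is_bundle_section sbar /\ euler_lagrange1 L sbar /\
        is_momentum_morphism H Hhat /\ associated L Lhat H Hhat /\
        Hhat \o Lhat \o sbar = sbar /\ r = Lhat \o sbar) ->
     let s := fun x => base (r x) in
     is_section s /\ is_jet_prolongation s sbar /\ euler_lagrange2 L s).
Proof.
have parti (H : hamiltonian_form F) Hhat r :
    is_momentum_morphism H Hhat -> associated L Lhat H Hhat ->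
    is_bundle_section r -> hamilton_equations H r ->
    (forall x, range Lhat (r x)) ->
    is_bundle_section (Hhat \o r) /\ euler_lagrange1 L (Hhat \o r).
  move=> hH hA hr eqs rQ.
  (* The values of [r] lie in the constraint space, where association makes [Hhat] a right inverse
     of [Lhat]. *)
  have LHr x : Lhat ((Hhat \o r) x) = r x by apply: hA.1.
  have hs := jet_section_smooth hLhat hH LHr (fun=> erefl) hr.
  split=> //.
  exact: (euler_lagrange1_hamilton hLhat hH LHr (fun=> erefl) hA hs).2 eqs.
split=> //; split.
  move=> sbar H Hhat hs el hH hA HLs.
  have HLsx x : Hhat ((Lhat \o sbar) x) = sbar x by rewrite -[in RHS]HLs.
  have Lsx x : Lhat (sbar x) = (Lhat \o sbar) x by [].
  split.
    exact: (legendre_section_smooth (r := Lhat \o sbar) hLhat Lsx hs).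
  split=> [|x]; last by exists (sbar x).
  exact: (euler_lagrange1_hamilton hLhat hH Lsx HLsx hA hs).1 el.
move=> sbar r hyp.
(* Both alternatives reduce to the same data: a smooth solution [sbar] of the first order equations
   whose Legendre image is [r], so that both lie over the same section of Y. *)
have [hs [el Lsbar]] : is_bundle_section sbar /\ euler_lagrange1 L sbar /\
    forall x, Lhat (sbar x) = r x.
  case: hyp => [[H [Hhat [hH [hA [hr [eqs [rQ ->]]]]]]]|].
    have [hs el] := parti H Hhat r hH hA hr eqs rQ.
    by split=> //; split=> // x; apply: hA.1.
  by move=> [H [Hhat [hs [el [_ [_ [_ ->]]]]]]].
rewrite /= (base_legendre_sectionE hLhat Lsbar); split; first exact: hs.1.
exact: euler_lagrange1_prolongation.
Qed.
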